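(* Let $x_0$ and $x_1$ be positive integers such that $x_1<x_0$. Then the method of least absolute remainders gives the least number of steps among all general Euclidean algorithms for this pair of integers. In other words, $S_m(x_0,x_1)\le S(x_0,x_1)$, where $S_m(x_0,x_1)$ is the number of steps of the method of least absolute remainders for $(x_0,x_1)$ and $S(x_0,x_1)$ is the number of steps of an arbitrary general Euclidean algorithm for $(x_0,x_1)$.
   Context: Let $x_0>x_1$ be positive integers. A general Euclidean algorithm for the pair $(x_0,x_1)$ is a finite list of $m\ge 1$ equations $$x_{i-1}=x_i p_i+\epsilon_{i+1}x_{i+1}\quad (1\le i\le m-1),\qquad x_{m-1}=x_m p_m,$$ where all $x_i$ are positive integers with $x_{i+1}<x_i$ for all $0\le i\le m-1$, all $p_i$ are positive integers, and each $\epsilon_i\in\{+1,-1\}$ $(2\le i\le m)$. (If $x_1$ divides $x_0$ the list consists of the single equation $x_0=x_1p_1$.) The number of steps of such an algorithm is $(m-1)+\sum_{i=1}^m p_i$ (each subtraction counts as one step, and each passage from the pair $(x_{i-1},x_i)$ to the pair $(x_i,x_{i+1})$ counts as one step). The method of least absolute remainders is the general Euclidean algorithm in which the remainder of smaller absolute value is chosen at each step, i.e. $2x_i\le x_{i-1}$ for all $i=2,\dots,m$; when both possible remainders have the same absolute value (i.e. $2x_i=x_{i-1}$), the positive remainder is chosen, i.e. $\epsilon_i=+1$. *)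

(* Defs.v *)
From mathcomp Require Import all_boot all_order all_algebra.

Set Implicit Arguments.
Unset Strict Implicit.
Unset Printing Implicit Defensive.

Import GRing.Theory.

(* The data of a list of m equations x_(i-1) = x_i p_i + eps_(i+1) x_(i+1).
   Only x_0, .., x_m, p_1, .., p_m and eps_2, .., eps_m are meaningful; the
   values of the three functions at other indices are unconstrained and are
   never used. *)
Record eqn_list := EqnList {
  eqn_size : nat;
  eqn_rem : nat -> nat;
  eqn_quo : nat -> nat;
  eqn_sgn : nat -> int
}.

Definition gen_euclid (x0 x1 : nat) (E : eqn_list) : Prop :=
  let: EqnList m x p eps := E in
  [/\ 1 <= m, x 0 = x0 & x 1 = x1] /\
  [/\ forall i, i <= m -> 0 < x i,
      forall i, i < m -> x i.+1 < x i,
      forall i, 1 <= i <= m -> 0 < p i &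
      forall i, 2 <= i <= m -> eps i = 1%R \/ eps i = (- 1)%R] /\
  (forall i, 1 <= i < m ->
     ((x i.-1)%:Z = (x i)%:Z * (p i)%:Z + eps i.+1 * (x i.+1)%:Z)%R) /\
  x m.-1 = x m * p m.

Definition steps (E : eqn_list) : nat :=
  (eqn_size E).-1 + \sum_(1 <= i < (eqn_size E).+1) eqn_quo E i.

Definition least_abs_rem (x0 x1 : nat) (E : eqn_list) : Prop :=
  gen_euclid x0 x1 E /\
  forall i, 2 <= i <= eqn_size E ->
    2 * eqn_rem E i <= eqn_rem E i.-1 /\
    (2 * eqn_rem E i = eqn_rem E i.-1 -> eqn_sgn E i = 1%R).

(* Main.v *)
Require Import Defs.
From mathcomp Require Import all_boot all_order all_algebra.
From mathcomp Require Import zify.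

(** Let f(a,b) be the least number of steps for (a,b).  For a = qb + r with
    0 < r < b the only possible first equations have remainder r (quotient q)
    or b - r (quotient q+1), so everything follows from the inequality
    f(b,s) + 1 <= f(b,b-s) for 0 < 2s < b, proved by induction on b.  An
    algorithm for (b,b-s) continues with (b-s,s) or with (b-s,b-2s).  In the
    first case use f(b,s) <= f(b-s,s) + 1.  In the second, the induction
    hypothesis replaces b-2s by s if 3s < b; if 3s > b, put t = b-2s < s, so
    that f(b,s) <= 3 + f(s,t) = 2 + f(s+t,t) and s+t = b-s. *)

Set Implicit Arguments.
Unset Strict Implicit.
Unset Printing Implicit Defensive.

Import GRing.Theory.

(* [run ok a b n]: some general Euclidean algorithm for (a,b) takes n steps
   and [ok x_(i-1) x_i eps_i] holds for all 2 <= i <= m. *)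
Inductive run (ok : nat -> nat -> int -> Prop) : nat -> nat -> nat -> Prop :=
| RunStop a b p : 0 < b -> b < a -> a = b * p -> run ok a b p
| RunStep a b c p e n : 0 < c < b -> b < a -> 0 < p ->
    e = 1%R \/ e = (-1)%R ->
    (a%:Z = b%:Z * p%:Z + e * c%:Z)%R -> ok b c e -> run ok b c n ->
    run ok a b (p + n).+1.

Definition any_rem (b c : nat) (e : int) : Prop := True.

Definition least_rem (b c : nat) (e : int) : Prop :=
  2 * c <= b /\ (2 * c = b -> e = 1%R).

Lemma run_of_eqn_list ok a b m x p e :
  gen_euclid a b (EqnList m x p e) ->
  (forall i, 2 <= i <= m -> ok (x i.-1) (x i) (e i)) ->
  run ok a b (steps (EqnList m x p e)).
Proof.
elim: m a b x p e => [|[|m] IH] a b x p e /=.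
- by case=> [[]].
- move=> [[_ <- <-] [[xpos xdec ppos _] [_ last]]] _.
  rewrite /steps /= add0n big_nat1.
  by apply: RunStop => //; [exact: xpos | exact: xdec].
move=> [[_ <- <-] [[xpos xdec ppos epos] [eqs last]]] okx.
have /= tail := IH (x 1) (x 2) (x \o S) (p \o S) (e \o S).
have -> : steps (EqnList m.+2 x p e) =
    (p 1 + steps (EqnList m.+1 (x \o S) (p \o S) (e \o S))).+1.
  by rewrite /steps /= big_ltn // big_add1 /=; lia.
apply: (@RunStep _ _ _ (x 2) _ (e 2)).
- by rewrite xpos // xdec.
- exact: xdec.
- exact: ppos.
- exact: epos.
- exact: (eqs 1).
- exact: (okx 2).
apply: tail; last by move=> [|[|i]] // hi; exact: (okx i.+3).
split=> //; split; [split|split] => //.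
- by move=> i hi; exact: xpos.
- by move=> i hi; exact: xdec.
- by move=> i hi; apply: ppos; lia.
- by move=> i hi; apply: epos; lia.
- by move=> [|i] // hi; exact: (eqs i.+2).
Qed.

Lemma eqn_list_of_run ok a b n : run ok a b n ->
  exists2 E, gen_euclid a b E &
    forall i, 2 <= i <= eqn_size E ->
      ok (eqn_rem E i.-1) (eqn_rem E i) (eqn_sgn E i).
Proof.
elim=> {a b n} [a b p b0 ba abp|a b c p e n cb ba p0 he eqa okc _ [E]].
  exists (EqnList 1 (fun i => if i is 0 then a else b) (fun=> p) (fun=> 1%R)).
    split=> //; split; [split|split] => //=.
    - by move=> [|i] _ //; lia.
    - by move=> [|i].
    - by move=> i _; case: p abp => //; lia.
    - by move=> i; lia.
    - by move=> i; lia.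
  by move=> i /=; lia.
case: E => m x q eps [[m0 x0 x1] [[xpos xdec qpos epos] [eqs last]]] /= okx.
(* Prepending an equation shifts every index by one; the patterns differ because remainders start at
   index 0, quotients at 1 and signs at 2. *)
exists (EqnList m.+1 (fun i => if i is j.+1 then x j else a)
  (fun i => if i is j.+2 then q j.+1 else p)
  (fun i => if i is j.+3 then eps j.+2 else e)).
  split=> //; split; [split|split] => //=.
  - by move=> [|i] hi; [lia | exact: xpos].
  - by move=> [|i] hi; [rewrite x0 | exact: xdec].
  - by move=> [|[|i]] // hi; exact: qpos.
  - by move=> [|[|[|i]]] // hi; exact: epos.
  - move=> [|[|i]] // hi /=; first by rewrite x0 x1.
    exact: (eqs i.+1).
  - by case: m m0 last {xpos xdec qpos epos eqs okx} => // m _.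
move=> [|[|[|i]]] //= hi; first by rewrite x0 x1.
exact: (okx i.+2).
Qed.

(** Both signed remainders lie strictly between [-b] and [b] and are congruent modulo [b], so they
    differ by 0, [b] or [-b]. *)
Lemma signed_rem_unique b p p' c c' (e e' : int) :
  0 < c < b -> 0 < c' < b ->
  e = 1%R \/ e = (-1)%R -> e' = 1%R \/ e' = (-1)%R ->
  (b%:Z * p%:Z + e * c%:Z = b%:Z * p'%:Z + e' * c'%:Z)%R ->
  [\/ [/\ p' = p, c' = c & e' = e],
      [/\ p' = p.+1, c + c' = b, e = 1%R & e' = (-1)%R]
    | [/\ p = p'.+1, c + c' = b, e = (-1)%R & e' = 1%R]].
Proof.
move=> hc hc' [] -> [] ->; rewrite ?mul1r ?mulN1r => h.
- have pp : p = p' by nia.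
  by apply: Or31; subst; split=> //; lia.
- have pp : p' = p.+1 by nia.
  by apply: Or32; subst; split=> //; nia.
- have pp : p = p'.+1 by nia.
  by apply: Or33; subst; split=> //; nia.
- have pp : p = p' by nia.
  by apply: Or31; subst; split=> //; lia.
Qed.

Lemma signed_rem_not_dvd b p q c (e : int) :
  0 < c < b -> e = 1%R \/ e = (-1)%R ->
  ((b * q)%:Z = b%:Z * p%:Z + e * c%:Z)%R -> False.
Proof.
move=> hc he h.
have h1 : (b%:Z * p%:Z + e * c%:Z = b%:Z * q%:Z)%R by lia.
by case: he h1 => ->; rewrite ?mul1r ?mulN1r; case: (ltngtP p q); nia.
Qed.

(** Raising the first quotient by one costs one subtraction and leaves the rest of the algorithm
    intact. *)
Lemma run_addr a b n : run any_rem a b n -> run any_rem (a + b) b n.+1.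
Proof.
case=> {a b n} [a b p b0 ba abp|a b c p e n cb ba p0 he eqa _ r].
  by apply: RunStop; rewrite ?mulnS; lia.
rewrite -addSn; apply: (RunStep cb _ _ he _ _ r) => //; first by lia.
by rewrite PoszD eqa -addn1 PoszD mulrDr mulr1; lia.
Qed.

(** Since [b < a], the first quotient is at least 2, so it can be lowered by one and stays
    positive. *)
Lemma run_subr a b n : b < a -> run any_rem (a + b) b n ->
  exists2 n', n = n'.+1 & run any_rem a b n'.
Proof.
move=> ba; move ab: (a + b) => s r.
case: r ba ab => {s b n} [s b p b0 _ sbp|s b c p e n cb _ p0 he eqs _ r] ba ab.
  case: p sbp => [|p] sbp; first by lia.
  by exists p => //; apply: RunStop => //; lia.
have p1 : 1 < p by case: he eqs => ->; rewrite ?mul1r ?mulN1r => eqs; nia.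
exists (p.-1 + n).+1; first by lia.
apply: (RunStep cb ba _ he _ _ r) => //; first by lia.
case: p p1 eqs {p0} => // p _; rewrite -addn1 PoszD mulrDr mulr1 -ab PoszD /=.
by lia.
Qed.

Lemma run_inv ok a b n : run ok a b n ->
  (exists2 p, n = p & a = b * p) \/
  (exists c p e n', [/\ n = (p + n').+1, 0 < c < b, e = 1%R \/ e = (-1)%R,
     (a%:Z = b%:Z * p%:Z + e * c%:Z)%R & run ok b c n']).
Proof.
case=> {a b n} [a b p _ _ abp|a b c p e n cb _ _ he eqa _ r].
  by left; exists p.
by right; exists c, p, e, n.
Qed.

Lemma run_small_rem_le b s n : 0 < s -> 2 * s < b ->
  run any_rem b (b - s) n -> exists2 n', n' < n & run any_rem b s n'.
Proof.
elim/ltn_ind: b s n => b IH s n s0 sb r.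
have add_small n' : run any_rem (b - s) s n' -> run any_rem b s n'.+1.
  by move/run_addr; rewrite subnK //; lia.
have sd : 0 < s < b - s by lia.
(* The reference equation: quotient 1 and remainder [s], against which any first equation for
   [(b, b - s)] is compared. *)
have eq1 : (b%:Z = (b - s)%:Z * 1%:Z + 1 * s%:Z)%R by rewrite mulr1 mul1r; lia.
case: (run_inv r) => [[p _ bp]|[c [p [e [k [-> cd he eqb rk]]]]]].
  by move: eq1; rewrite {1}bp => /(signed_rem_not_dvd sd (or_introl erefl)).
have [[_ cs _]|[-> sc _ _]|[p0 _ _ h]] :=
    signed_rem_unique sd cd (or_introl erefl) he (etrans (esym eq1) eqb).
- exists k.+1; first by lia.
  by rewrite cs in rk; exact: add_small.
(* Quotient 2 with a negative sign: 3 steps are spent before the [k] steps for [(b - s, b - 2s)]. *)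
- have defc : c = b - s - s by lia.
  have bs : b - s < b by lia.
  have [s3|s3|s3] := ltngtP (2 * s) (b - s).
  + rewrite defc in rk; have [n' n'k r'] := IH _ bs s k s0 s3 rk.
    by exists n'.+1; [lia | exact: add_small].
  (* Here [b - s = s + c] with [c < s], so one subtraction can be removed to reach [(s, c)]; the
     equation [b = 2s + c] leads there directly from [(b, s)]. *)
  + have [k' -> r'] : exists2 k', k = k'.+1 & run any_rem s c k'.
      apply: run_subr; first by lia.
      by rewrite sc.
    exists (2 + k').+1; first by lia.
    apply: (RunStep (e := 1%R) _ _ _ _ _ _ r') ; by [|lia].
  + exists k.+1; first by lia.
    have cs : c = s by lia.
    by rewrite cs in rk; exact: add_small.
(* Quotient 0 would force [b = c < b - s]. *)
- have p00 : p = 0 by lia.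
  by move: eqb; rewrite p00 h mulr0 add0r mul1r; lia.
Qed.

Lemma least_rem_run_minimal a b n n' :
  run least_rem a b n -> run any_rem a b n' -> n <= n'.
Proof.
move=> r; elim: r n' => {a b n}
  [a b p b0 ba abp|a b c p e n cb ba p0 he eqa okc _ IH] n' r'.
  case: (run_inv r') => [[p' -> abp']|[c [p' [e [k [_ cb he eqa _]]]]]].
    by nia.
  by move: eqa; rewrite abp => /(signed_rem_not_dvd cb he).
case: (run_inv r') => [[p' _ abp']|[c' [p' [e' [k [-> cb' he' eqa' r]]]]]].
  by move: eqa; rewrite abp' => /(signed_rem_not_dvd cb he).
have [c2 c2e] := okc.
have [[-> cc _]|[-> cc _ _]|[-> cc e1 _]] :=
    signed_rem_unique cb cb' he he' (etrans (esym eqa) eqa').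
- by rewrite cc in r; have := IH _ r; lia.
- have [c2b|c2b] := eqVneq (2 * c) b.
    (* In a tie both choices continue with the same pair, and the negative sign only costs a larger
       quotient. *)
    by have c'c : c' = c; [lia | rewrite c'c in r; have := IH _ r; lia].
  have def_c' : c' = b - c by lia.
  rewrite def_c' in r.
  have [||j jk /IH] := run_small_rem_le _ _ r; lia.
(* The sign [-1] rules out a tie. The competitor's quotient is smaller by one, which the strict
   inequality [j < k] below compensates. *)
- have c2b : 2 * c < b.
    by rewrite ltn_neqAle c2 andbT; apply/eqP => /c2e; rewrite e1.
  have def_c' : c' = b - c by lia.
  rewrite def_c' in r.
  have [||j jk /IH] := run_small_rem_le _ _ r; lia.
Qed.

Lemma run_least_rem a b : 0 < b -> b < a -> exists n, run least_rem a b n.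
Proof.
elim/ltn_ind: b a => b IH a b0 ba.
have q0 : 0 < a %/ b by rewrite divn_gt0 // ltnW.
have rb := ltn_pmod a b0; have eqa := divn_eq a b.
case: (posnP (a %% b)) => [r0|r0].
  by exists (a %/ b); apply: RunStop => //; lia.
(* The non-strict comparison sends ties to the positive remainder. *)
case: (leqP (2 * (a %% b)) b) => [small|big].
  have [n r] := IH _ rb b r0 rb.
  exists (a %/ b + n).+1; apply: (RunStep (e := 1%R) _ ba q0 _ _ _ r).
  - by rewrite r0.
  - by left.
  - by rewrite {1}eqa PoszD PoszM mul1r mulrC.
  - by split.
have [//|||n r] := IH (b - a %% b) _ b; [lia..|].
exists ((a %/ b).+1 + n).+1.
apply: (RunStep (e := (-1)%R) _ ba _ _ _ _ r) => //.
- by lia.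
- by right.
- by rewrite {1}eqa -addn1 PoszD PoszM PoszD mulN1r mulrDr mulr1; lia.
- by split; lia.
Qed.

Theorem theorem5p1 (x0 x1 : nat) (x1_gt0 : 0 < x1) (x1_lt_x0 : x1 < x0) :
  (exists L : eqn_list, least_abs_rem x0 x1 L) /\
  (forall L E : eqn_list,
     least_abs_rem x0 x1 L -> gen_euclid x0 x1 E -> steps L <= steps E).
Proof.
split.
  have [n /eqn_list_of_run [L genL okL]] := run_least_rem x1_gt0 x1_lt_x0.
  by exists L; split.
case=> m x p e [m' x' p' e'] [genL okL] genE.
apply: (least_rem_run_minimal (a := x0) (b := x1)).
  exact: run_of_eqn_list genL okL.
exact: run_of_eqn_list genE _.
Qed.
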